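(* Let $\pi=\{p_1,\ldots,p_n\}$ be a finite set of primes and let $G$ be a finite group. Suppose that $G$ has subgroups $A_1,A_2,A_3,A_4$ such that the indices $|G:A_1|,|G:A_2|,|G:A_3|,|G:A_4|$ are pairwise coprime and each of them is either a $\pi$-number or a $\pi'$-number. Suppose also that at most one of the numbers $|G:A_1|,|G:A_2|,|G:A_3|,|G:A_4|$ is a $\pi'$-number. If the derived subgroup $A_i'$ of $A_i$ is $\pi$-special for all $i=1,2,3,4$, then the derived subgroup $G'$ of $G$ is $\pi$-special.
   Context: All groups are finite. $\pi'$ is the set of primes not in $\pi$. A $\pi$-number (respectively $\pi'$-number) is a positive integer all of whose prime divisors lie in $\pi$ (respectively $\pi'$). A group $G$ is $\pi$-special if $G=O_{p_1}(G)\times\cdots\times O_{p_n}(G)\times O_{\pi'}(G)$. *)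

(* Defs.v *)
From mathcomp Require Import all_boot all_fingroup all_solvable.

Set Implicit Arguments.
Unset Strict Implicit.
Unset Printing Implicit Defensive.

Import GroupScope.

Definition prime_pred (s : seq nat) : nat_pred := [pred p in s].

(* [s] lists the primes of pi without repetition.  The operation [\x] is
   partial: it returns [set0], which is never a group, unless its arguments
   are groups that centralise each other and intersect trivially; so this
   equation states that G is the internal direct product of the cores. *)
Definition pi_special (s : seq nat) (gT : finGroupType) (G : {set gT}) : Prop :=
  (\big[dprod/1]_(p <- s) 'O_p(G)) \x 'O_((prime_pred s)^')(G) = G.

(* Main.v *)
(** Colour the primes: one colour for each prime of pi, one for all of pi'.
    For each colour tau, all but one of the A_i have tau'-index in G.  A normal
    tau-subgroup of some A_i lies in every A_j, j <> i, of tau'-index, hence in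
    the normal core of A_j; so, as in Wielandt's solvability theorem, some
    R = O_tau(G) is nontrivial.  By induction the claim holds for G/R.
    Put C = C_G(R) and E/C = O_tau(G/C).  Three of the A_i contain R, so the
    tau'-part of A_i' centralises R and A_i'C/C is a tau-group.  But E contains
    R, so by induction (G/E)' is the direct product of its O_rho over all
    colours rho, hence a tau'-group since
    O_tau(G/E) = 1.  Thus the three images A_iE/E are abelian; having pairwise
    coprime indices they force G/E to be abelian, as X :&: Y is central in XY.
    Hence G'C/C is a tau-group, and with (G/R)' this lets every Hall subgroup
    of G'R/R lift to a normal Hall subgroup of G'R. *)

Require Import Defs.
From mathcomp Require Import all_boot all_fingroup all_solvable.

Set Implicit Arguments.
Unset Strict Implicit.
Unset Printing Implicit Defensive.

Import GroupScope.

(** * Coprime indices and factorisations *)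

(** Coprime indices give [G = A B], so [|A : A :&: B| = |G : B|]. As [A :&: B] normalises [N], the
    index of [N :&: B] in [N] divides this pi'-number, yet it is a pi-number. *)
Lemma normal_pgroup_sub_coprime_index pi (gT : finGroupType)
    (G A B N : {group gT}) :
  A \subset G -> B \subset G -> coprime #|G : A| #|G : B| ->
  N <| A -> pi.-group N -> pi^'.-nat #|G : B| -> N \subset B.
Proof.
move=> sAG sBG co /andP[sNA nNA] piN pi'B.
have eAB : #|A : A :&: B| = #|G : B|.
  by rewrite indexgI -(coprime_index_mulG sBG sAG) 1?coprime_sym // indexMg.
have nMN : A :&: B \subset 'N(N) by rewrite subIset ?nNA.
have dvd : #|N : A :&: B| %| #|G : B|.
  rewrite -eAB -[#|N : _|]indexMg -norm_joinEl // indexSg ?joing_subl //.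
  by rewrite join_subG subsetIl.
have pi'N : pi^'.-nat #|N : A :&: B| by apply: pnat_dvd dvd pi'B.
have piN' : pi.-nat #|N : A :&: B| by apply: pnat_dvd (dvdn_indexg _ _) piN.
have : #|N : A :&: B| == 1%N by apply/eqP; apply: pnat_1 piN' pi'N.
by rewrite indexg_eq1 subsetI => /andP[].
Qed.

Lemma norm_TI_cents (gT : finGroupType) (H K : {group gT}) :
  H \subset 'N(K) -> K \subset 'N(H) -> H :&: K = 1 -> H \subset 'C(K).
Proof.
move=> nKH nHK tiHK; apply/commG1P/trivgP.
by rewrite -tiHK subsetI commg_subl nHK commg_subr.
Qed.

(** A prime dividing [#|G : 'Z(G)|] would divide one of any two of the indices, because
    [X i :&: X j] is central; so it would divide two of the three, against coprimality. *)
Lemma abelian_three_coprime_index (gT : finGroupType) (G : {group gT})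
    (X : 'I_3 -> {group gT}) :
  (forall i, X i \subset G) -> (forall i, abelian (X i)) ->
  (forall i j, i != j -> coprime #|G : X i| #|G : X j|) -> abelian G.
Proof.
move=> sXG abX coX.
have sXZ i j : i != j -> X i :&: X j \subset 'Z(G).
  move=> nij; rewrite subsetI subIset ?sXG //=.
  rewrite -(coprime_index_mulG (sXG i) (sXG j) (coX _ _ nij)) centM.
  by rewrite setISS // [_ \subset 'C(_)]abX.
have dvdZ i j : i != j -> #|G : 'Z(G)| %| #|G : X i| * #|G : X j|.
  move=> nij; apply: dvdn_trans (indexgS _ (sXZ _ _ nij)) _.
  rewrite -(Lagrange_index (sXG i) (subsetIl _ _)) dvdn_pmul2l ?indexg_gt0 //.
  by rewrite indexgI -(coprime_index_mulG (sXG j) (sXG i)) ?indexMg //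
    coX // eq_sym.
suff : #|G : 'Z(G)| == 1%N.
  by rewrite indexg_eq1 /abelian => /subset_trans; apply; apply: subsetIr.
apply: contraT => nZ.
have /pdivP[p pr_p pZ] : 1 < #|G : 'Z(G)|.
  by rewrite ltn_neqAle eq_sym nZ indexg_gt0.
have pX i j : i != j -> (p %| #|G : X i|) || (p %| #|G : X j|).
  by move=> nij; rewrite -Euclid_dvdM // (dvdn_trans pZ) ?dvdZ.
have npX i j : i != j -> ~~ ((p %| #|G : X i|) && (p %| #|G : X j|)).
  move=> nij; apply/negP; rewrite -dvdn_gcd (eqnP (coX _ _ nij)) dvdn1.
  move/eqP=> p1.
  by rewrite p1 in pr_p.
have d01 : ord0 != inord 1 :> 'I_3 by rewrite -val_eqE /= inordK.
have d02 : ord0 != inord 2 :> 'I_3 by rewrite -val_eqE /= inordK.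
have d12 : inord 1 != inord 2 :> 'I_3 by rewrite -val_eqE /= !inordK.
have := (pX _ _ d01, pX _ _ d02, pX _ _ d12).
have := (npX _ _ d01, npX _ _ d02, npX _ _ d12).
by do 3!case: (p %| _); case=> [[? ?] ?] [[? ?] ?].
Qed.

(** * Direct products of Hall subgroups along a colouring of the primes *)

Definition colour_class (c : nat -> nat) k : nat_pred := [pred q | c q == k].

(* A partition sigma of the primes is encoded by a colouring [c]; colours
   attained by no prime give the trivial Hall subgroup. *)
Definition sigma_nilpotent c (gT : finGroupType) (G : {set gT}) :=
  forall k, (colour_class c k).-Hall(G) 'O_(colour_class c k)(G).

Section SigmaNilpotent.

Variable c : nat -> nat.
Local Notation cc := (colour_class c).

Lemma sub_colour_class' j k : j != k -> {subset cc j <= (cc k)^'}.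
Proof. by move=> njk q; rewrite !inE => /eqP->. Qed.

Lemma sigma_nilpotentS (gT : finGroupType) (G H : {group gT}) :
  H \subset G -> sigma_nilpotent c G -> sigma_nilpotent c H.
Proof.
move=> sHG nilG k; have := setI_normal_Hall (pcore_normal _ _) (nilG k) sHG.
move=> hall; rewrite (normal_Hall_pcore hall) //.
by rewrite /normal subsetIr normsI ?normG // (subset_trans sHG) ?gFnorm.
Qed.

Lemma quotient_sigma_nilpotent (gT : finGroupType) (G N : {group gT}) :
  G \subset 'N(N) -> sigma_nilpotent c G -> sigma_nilpotent c (G / N).
Proof.
move=> nNG nilG k.
have hall : (cc k).-Hall(G / N) ('O_(cc k)(G) / N).
  by apply: quotient_pHall (nilG k); rewrite (subset_trans (pcore_sub _ _)).
by rewrite (normal_Hall_pcore hall) // quotient_normal ?pcore_normal.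
Qed.

Lemma abelian_sigma_nilpotent (gT : finGroupType) (G : {group gT}) :
  abelian G -> sigma_nilpotent c G.
Proof. by move=> abG k; rewrite nilpotent_pcore_Hall ?abelian_nil. Qed.

Lemma sigma_nilpotent_pcore_neq1 (gT : finGroupType) (G : {group gT}) :
  sigma_nilpotent c G -> G :!=: 1 -> exists k, 'O_(cc k)(G) != 1.
Proof.
move=> nilG; rewrite trivg_card1 => ntG.
have /pdivP[p pr_p pG] : 1 < #|G| by rewrite ltn_neqAle eq_sym ntG cardG_gt0.
exists (c p); apply/eqP => O1; have := nilG (c p).
rewrite /pHall O1 indexg1 => /and3P[_ _ pi'G].
by have := pnatP _ (cardG_gt0 _) pi'G p pr_p pG; rewrite !inE eqxx.
Qed.

Lemma der1_sigma_nilpotent_pcore_neq1 (gT : finGroupType) (G : {group gT}) :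
  sigma_nilpotent c G^`(1) -> G :!=: 1 -> exists k, 'O_(cc k)(G) != 1.
Proof.
move=> nilG' ntG; have [G'1 | ntG'] := eqVneq G^`(1) 1.
  apply: sigma_nilpotent_pcore_neq1 => //; apply: abelian_sigma_nilpotent.
  by apply/commG1P.
have [k ntk] := sigma_nilpotent_pcore_neq1 nilG' ntG'; exists k.
apply: subG1_contra ntk; apply: pcore_max; first exact: pcore_pgroup.
by rewrite !gFnormal_trans.
Qed.

Lemma sigma_nilpotent_quotient_pgroup k (gT : finGroupType)
    (G N : {group gT}) :
  sigma_nilpotent c G -> G \subset 'N(N) ->
  (forall j, j != k -> 'O_(cc j)(G) \subset N) -> (cc k).-group (G / N).
Proof.
move=> nilG nNG sON; apply/pgroupP => p pr_p pG; rewrite inE.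
apply: contraLR pG => npk; have := sON _ npk => /quotientS1 O1.
have : (cc (c p)).-Hall(G / N) ('O_(cc (c p))(G) / N).
  by apply: quotient_pHall (nilG _); rewrite (subset_trans (pcore_sub _ _)).
rewrite O1 /pHall indexg1 => /and3P[_ _ pi'].
apply/negP => pG; have := pnatP _ (cardG_gt0 _) pi' p pr_p pG.
by rewrite !inE eqxx.
Qed.

(* The Hall subgroup for a colour [j != k] is found inside the centraliser of
   [R], where Schur-Zassenhaus splits off the central part lying in [R]. *)
Lemma sigma_nilpotent_ext k (gT : finGroupType) (G R : {group gT}) :
  R <| G -> (cc k).-group R -> sigma_nilpotent c (G / R) ->
  (cc k).-group (G / 'C_G(R)) -> sigma_nilpotent c G.
Proof.
move=> nsRG kR nilGR kGC j; have [sRG nRG] := andP nsRG.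
have [-> | njk] := eqVneq j k.
  rewrite /pHall pcore_sub pcore_pgroup /=.
  have sRO : R \subset 'O_(cc k)(G) by apply: pcore_max.
  have sGRO := subset_trans (subsetIr G R) sRO.
  rewrite -(index_quotient_eq sGRO (pcore_sub _ _) nRG) /=.
  by rewrite -pquotient_pcore //; have /and3P[] := nilGR k.
have [T defT sRT nsTG] := inv_quotientN nsRG (pcore_normal (cc j) (G / R)).
have [sTG nTG] := andP nsTG.
pose C := 'C_G(R)%G; have nsCG : C <| G.
  by rewrite /normal subsetIl normsI ?normG ?norms_cent.
have [sCG nCG] := andP nsCG.
(* [D / W] embeds in [T / R], which has colour [j], and [W] has colour [k], so [W] has a complement
   [V] in [D]. Since [W] is central in [D], [V] is normal. *)
pose D := (T :&: C)%G; pose W := (D :&: R)%G.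
have nsDG : D <| G by rewrite normalI.
have nsWG : W <| G by rewrite normalI.
have sDG := normal_sub nsDG.
have kW : (cc k).-group W by apply: pgroupS kR; apply: subsetIr.
have j'k n : (cc k).-nat n -> (cc j)^'.-nat n.
  by apply: sub_in_pnat => q _; apply: sub_colour_class'; rewrite eq_sym.
have jDW : (cc j).-nat #|D : W|.
  rewrite indexgI -(card_quotient (subset_trans sDG nRG)).
  apply: pgroupS (pcore_pgroup (cc j) (G / R)).
  by rewrite defT quotientS ?subsetIl.
have hallW : Hall D W.
  rewrite /Hall subsetIl coprime_sym /=.
  exact: pnat_coprime jDW (j'k _ kW).
have /splitsP[V /complP[tiWV defD]] :=
  SchurZassenhaus_split hallW (normalS (subsetIl _ _) sDG nsWG).
have sVD : V \subset D by rewrite -defD mulG_subr.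
have cWD : D \subset 'C(W).
  rewrite centsC (subset_trans (subsetIr _ _)) // centsC.
  by rewrite 3?subIset ?subxx ?orbT.
have nsVD : V <| D.
  rewrite /normal sVD -defD mulG_subG normG andbT.
  by rewrite cents_norm // centsC (subset_trans sVD).
have iDV : #|D : V| = #|W|.
  apply/eqP; rewrite -(eqn_pmul2l (cardG_gt0 V)) Lagrange //.
  by rewrite mulnC -TI_cardMg // defD.
have jV : (cc j).-group V.
  apply: etrans jDW; congr (pnat _ _).
  apply/eqP; rewrite -(eqn_pmul2l (cardG_gt0 W)) Lagrange ?subsetIl //.
  by rewrite -TI_cardMg // defD.
have sVO : V \subset 'O_(cc j)(G).
  apply: subset_trans (pcore_max jV nsVD) _.
  by apply: pcore_max; rewrite ?pcore_pgroup ?gFnormal_trans.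
rewrite /pHall pcore_sub pcore_pgroup /=.
apply: pnat_dvd (indexgS _ sVO) _.
(* [|G : V| = |G : T| |T : D| |D : V|]: the first factor is prime to colour [j] because [T / R] is a
   Hall subgroup of [G / R], and the other two have colour [k]. *)
rewrite -(Lagrange_index sDG sVD) -(Lagrange_index sTG (subsetIl _ _)) iDV.
rewrite !pnatM (j'k _ kW) andbT; apply/andP; split.
  rewrite -(index_quotient_eq (subset_trans (subsetIr _ _) sRT) sTG nRG) /=.
  by rewrite -defT; have /and3P[] := nilGR j.
rewrite indexgI -(card_quotient (subset_trans sTG nCG)); apply: j'k.
by apply: pgroupS kGC; apply: quotientS.
Qed.

(** * Four subgroups of coprime indices, and the induction *)

(** Stated by colours so as to pass to quotients: there several indices may become 1, which is also
    a pi'-number, so the bound on the number of pi'-indices would be lost. *)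
Definition sigma_cover (gT : finGroupType) (G : {group gT})
    (A : 'I_4 -> {group gT}) :=
  [/\ forall i, A i \subset G,
      forall i j, i != j -> coprime #|G : A i| #|G : A j|,
      forall k, exists i0, forall i, i != i0 -> (cc k)^'.-nat #|G : A i|
    & forall i, sigma_nilpotent c (A i)^`(1)].

Lemma quotient_sigma_cover (gT : finGroupType) (G N : {group gT}) A :
  N <| G -> sigma_cover G A -> sigma_cover (G / N) (fun i => A i / N)%G.
Proof.
case/andP=> _ nNG [sAG coA ccA nilA].
have dvdA i : #|G / N : A i / N| %| #|G : A i|.
  by rewrite index_quotient // subIset ?nNG.
split=> [i | i j nij | k | i] /=.
- exact: quotientS.
- exact: coprime_dvdl (dvdA i) (coprime_dvdr (dvdA j) (coA _ _ nij)).
- have [i0 ccAk] := ccA k; exists i0 => i ni0.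
  exact: pnat_dvd (dvdA i) (ccAk i ni0).
have nNA := subset_trans (sAG i) nNG.
rewrite -quotient_der //; apply: quotient_sigma_nilpotent (nilA i).
by rewrite (subset_trans (der_sub _ _)).
Qed.

Lemma sigma_cover_pcore_neq1 (gT : finGroupType) (G : {group gT}) A :
  sigma_cover G A ->
  sigma_nilpotent c G^`(1) \/ exists k, 'O_(cc k)(G) != 1.
Proof.
move=> [sAG coA ccA nilA]; pose i1 : 'I_4 := ord0.
have [A1 | ntA1] := eqVneq (A i1 : {set gT}) 1.
  (* The index of [A i1 = 1] is [|G|], so coprimality forces another [A i] to be all of [G]. *)
  left; have n12 : i1 != lift i1 ord0 by apply: neq_lift.
  have : #|G : A (lift i1 ord0)| == 1%N.
    have := coA _ _ n12; rewrite A1 indexg1 coprime_sym.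
    by rewrite /coprime (gcdn_idPl (dvdn_indexg _ _)).
  rewrite indexg_eq1 => sGA; apply: sigma_nilpotentS (nilA (lift i1 ord0)).
  exact: dergS.
right.
have [k ntk] := der1_sigma_nilpotent_pcore_neq1 (nilA i1) ntA1.
have [i0 ccAk] := ccA k.
have [j nj1 nj0] : exists2 j, i1 != j & j != i0.
  have [i0E | n0] := eqVneq i0 (lift i1 ord0).
    exists (lift i1 ord_max); first exact: neq_lift.
    by rewrite i0E (inj_eq lift_inj).
  by exists (lift i1 ord0); rewrite ?neq_lift // eq_sym.
have sNA := normal_pgroup_sub_coprime_index (sAG i1) (sAG j) (coA _ _ nj1)
  (pcore_normal _ _) (pcore_pgroup _ _) (ccAk _ nj0).
pose L := gcore (A j) G; have nsLG : L <| G by apply: gcore_normal.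
have sLA : L \subset A j by apply: gcore_sub.
have ntL : L :!=: 1.
  (* For [x = b a] the conjugate of [A j] by [x] is that by [a], and [a] normalises
     ['O_(cc k)(A i1)]. *)
  apply: subG1_contra ntk; apply/bigcapsP => x.
  rewrite -(coprime_index_mulG (sAG j) (sAG i1)); last first.
    by rewrite coprime_sym coA.
  case/mulsgP => b a Ab Aa ->; rewrite conjsgM conjGid // -sub_conjgV.
  by rewrite (normP _) // groupV (subsetP (gFnorm _ _)).
have nilL : sigma_nilpotent c L^`(1).
  exact: sigma_nilpotentS (dergS 1 sLA) (nilA j).
(* The core [L] need not have colour [k], so a possibly different colour [m] is read off from it. *)
have [m ntm] := der1_sigma_nilpotent_pcore_neq1 nilL ntL; exists m.
apply: subG1_contra ntm; apply: pcore_max; first exact: pcore_pgroup.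
by rewrite gFnormal_trans.
Qed.

(** The Hall subgroup of colour [k] of the derived group of [G] lies in ['O_(cc k)(G) = 1], so the
    derived groups of the [A i], [i != i0], have coprime colours at once and vanish. *)
Lemma sigma_cover_abelian k (gT : finGroupType) (G : {group gT}) A i0 :
  sigma_cover G A -> sigma_nilpotent c G^`(1) -> 'O_(cc k)(G) = 1 ->
  (forall i, i != i0 -> (cc k).-group (A i)^`(1)) -> abelian G.
Proof.
move=> [sAG coA _ _] nilG Ok1 kA.
have k'G : (cc k)^'.-group G^`(1).
  have := nilG k; suff -> : 'O_(cc k)(G^`(1)) = 1.
    by rewrite /pHall indexg1 => /and3P[].
  apply/trivgP; rewrite -Ok1; apply: pcore_max; first exact: pcore_pgroup.
  by rewrite !gFnormal_trans.
apply: (@abelian_three_coprime_index _ _ (fun i => A (lift i0 i)))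
  => // [i | i j nij].
  apply/commG1P/eqP; rewrite -derg1 trivg_card1; apply/eqP.
  apply: pnat_1 (kA _ _) (pgroupS (dergS 1 (sAG _)) k'G).
  by rewrite eq_sym neq_lift.
by rewrite coA // (inj_eq lift_inj).
Qed.

Theorem sigma_cover_der1_nilpotent (gT : finGroupType) (G : {group gT}) A :
  sigma_cover G A -> sigma_nilpotent c G^`(1).
Proof.
have [n] := ubnP #|G|; elim: n => // n IHn in gT G A *.
rewrite ltnS => leGn covG.
have [// | [k ntR]] := sigma_cover_pcore_neq1 covG.
pose R := 'O_(cc k)(G)%G.
have kR : (cc k).-group R := pcore_pgroup _ _.
have nsRG : R <| G := pcore_normal _ _.
have [sRG nRG] := andP nsRG.
pose C := 'C_G(R)%G; have nsCG : C <| G.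
  by rewrite /normal subsetIl normsI ?normG ?norms_cent.
have [sCG nCG] := andP nsCG.
pose E := 'O_(cc k)(G / C)%G.
have nEG : G / C \subset 'N(E) := gFnorm _ _.
have nCR : R \subset 'N(C) := subset_trans sRG nCG.
have sRE : R / C \subset E.
  by apply: pcore_max; rewrite ?quotient_pgroup ?quotient_normal.
have covH := quotient_sigma_cover (pcore_normal (cc k) _)
  (quotient_sigma_cover nsCG covG).
have ltHn : #|G / C / E| < n.
  (* If [C = 1], then [R] embeds in [E], so [E] is nontrivial and the order still drops. *)
  apply: leq_trans leGn; have [C1 | ntC] := eqVneq (C : {set gT}) 1.
    apply: leq_trans (leq_quotient _ _); apply: ltn_quotient (pcore_sub _ _).
    apply: contra_neq ntR => E1; apply/trivgP.
    have sRC : R \subset C.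
      by rewrite -quotient_sub1 //; apply: subset_trans sRE _; rewrite E1.
    by apply: subset_trans sRC _; rewrite C1.
  exact: leq_ltn_trans (leq_quotient _ _) (ltn_quotient ntC sCG).
have [sAG coA ccA nilA] := covG; have [i0 ccAk] := ccA k.
have abH : abelian (G / C / E).
  apply: (sigma_cover_abelian (i0 := i0) covH (IHn _ _ _ ltHn covH))
    => [|i ni0].
    exact: trivg_pcore_quotient.
  have sRA : R \subset A i.
    apply: normal_pgroup_sub_coprime_index (subxx G) (sAG i) _ nsRG kR
      (ccAk i ni0).
    by rewrite indexgg coprime1n.
  have nCA := subset_trans (sAG i) nCG.
  have nEA : A i / C \subset 'N(E) := subset_trans (quotientS _ (sAG i)) nEG.
  rewrite /= -!quotient_der // quotient_pgroup //.
  have sA'G := subset_trans (der_sub 1 _) (sAG i).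
  apply: sigma_nilpotent_quotient_pgroup (nilA i) _ _ => [|j njk].
    exact: subset_trans nCG.
  (* [R] lies in [A i], so this core and [R] normalise each other; their orders are coprime, so they
     commute. *)
  have sOA : 'O_(cc j)((A i)^`(1)) \subset A i := gFsub_trans _ (der_sub 1 _).
  rewrite subsetI (subset_trans sOA) //; apply: norm_TI_cents.
  - by rewrite (subset_trans sOA) // (subset_trans (sAG i)).
  - by rewrite (subset_trans sRA) // !gFnorm_trans.
  apply: coprime_TIg; apply: pnat_coprime (pcore_pgroup _ _) _.
  apply: sub_in_pnat kR => q _; apply: sub_colour_class'.
  by rewrite eq_sym.
have sG'G : G^`(1) \subset G := der_sub 1 _.
have sXG : G^`(1) <*> R \subset G by rewrite join_subG sG'G.
(* The derived group need not contain [R], so the extension lemma is applied to its product with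
   [R]. *)
apply: (@sigma_nilpotentS _ (G^`(1) <*> R)); first exact: joing_subl.
apply: (@sigma_nilpotent_ext k _ _ R) => //.
- by rewrite /normal joing_subr (subset_trans sXG).
- rewrite quotientYidr ?(subset_trans sG'G) // quotient_der //.
  apply: IHn (quotient_sigma_cover nsRG covG).
  exact: leq_trans (ltn_quotient ntR sRG) leGn.
suff: (cc k).-group ((G^`(1) <*> R) / C).
  have nCX := normsI (normG _) (norms_cent (subset_trans sXG nRG)).
  rewrite /pgroup card_quotient ?(subset_trans sXG) // card_quotient //.
  by rewrite -[#|_ : C|]indexgI setIA (setIidPl sXG).
apply: pgroupS (pcore_pgroup (cc k) (G / C)).
rewrite /= quotientY ?(subset_trans sG'G) // join_subG sRE andbT.
by rewrite quotient_der // der1_min.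
Qed.

End SigmaNilpotent.

(** * Translation between pi-special groups and colourings *)

Section PiSpecial.

Variable s : seq nat.
Hypotheses (uniq_s : uniq s) (prime_s : forall p, p \in s -> prime p).

(** As 0 is not a prime, it is free to serve as the common colour of pi'. *)
Definition pi_colour (s : seq nat) q := if q \in s then q else 0%N.
Local Notation cc := (colour_class (pi_colour s)).

Lemma colour_class_prime p : p \in s -> cc p =i (p : nat_pred).
Proof.
move=> sp q; rewrite !inE /pi_colour; case: ifP => // /negbT nsq.
have /negPf-> : q != p by apply: contraNneq nsq => ->.
by rewrite eq_sym eqn0Ngt prime_gt0 ?prime_s.
Qed.

Lemma colour_class0 : cc 0 =i (prime_pred s)^'.
Proof.
move=> q; rewrite !inE /pi_colour; case: ifP => //= /prime_s/prime_gt0.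
by rewrite lt0n => /negPf.
Qed.

Lemma pi_special_sigma_nilpotent (gT : finGroupType) (G : {group gT}) :
  pi_special s G -> sigma_nilpotent (pi_colour s) G.
Proof.
rewrite /pi_special => defG k; have oG := dprod_card defG.
have [[K L defK _] _ _ _] := dprodP defG.
rewrite defK -(bigdprod_card defK) in oG.
rewrite /pHall pcore_sub pcore_pgroup /=.
have [sk | nsk] := boolP (k \in s).
  rewrite (eq_pcore _ (colour_class_prime sk)).
  rewrite (eq_pnat _ (eq_negn (colour_class_prime sk))).
  move: oG; rewrite (bigD1_seq k) //= -mulnA.
  rewrite -(Lagrange (pcore_sub k G)) => /eqP.
  rewrite eqn_pmul2l ?cardG_gt0 // => /eqP <-.
  rewrite pnatM; apply/andP; split.
    apply: (big_ind (fun n => k^'.-nat n)) => // [m n | p npk].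
      by rewrite pnatM => -> ->.
    apply: sub_in_pnat (pcore_pgroup p G) => q _; rewrite !inE => /eqP->.
    exact: npk.
  apply: sub_in_pnat (pcore_pgroup _ G) => q _; rewrite !inE.
  by apply: contraNneq => ->.
have [-> | nk0] := eqVneq k 0%N.
  rewrite (eq_pcore _ colour_class0) (eq_pnat _ (eq_negn colour_class0)) pnatNK.
  move: oG; rewrite mulnC -(Lagrange (pcore_sub (prime_pred s)^' G)) => /eqP.
  rewrite eqn_pmul2l ?cardG_gt0 // => /eqP <-.
  rewrite big_seq; apply: (big_ind (fun n => (prime_pred s).-nat n))
    => // [m n | p sp].
    by rewrite pnatM => -> ->.
  by apply: sub_in_pnat (pcore_pgroup p G) => q _; rewrite !inE => /eqP->.
(* No number has such a colour [k]. *)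
apply/pnatP => // q _ _; rewrite !inE /pi_colour.
case: ifP => [sq | _]; last by rewrite eq_sym.
by apply: contraNneq nsk => <-.
Qed.

Lemma sigma_nilpotent_pi_special (gT : finGroupType) (G : {group gT}) :
  sigma_nilpotent (pi_colour s) G -> pi_special s G.
Proof.
move=> nilG.
have hallp p : p \in s -> p.-Hall(G) 'O_p(G).
  move=> sp; rewrite -(eq_pcore _ (colour_class_prime sp)).
  by rewrite -(eq_pHall _ _ (colour_class_prime sp)).
have hall' : (prime_pred s)^'.-Hall(G) 'O_(prime_pred s)^'(G).
  by rewrite -(eq_pcore _ colour_class0) -(eq_pHall _ _ colour_class0).
have dprod_normal pi (H K : {group gT}) :
  H <| G -> K <| G -> pi.-group H -> pi^'.-group K -> H \x K = H * K.
- move=> /andP[sHG nHG] /andP[sKG nKG] piH pi'K.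
  have tiHK := coprime_TIg (pnat_coprime piH pi'K).
  apply: dprodE => //; rewrite centsC norm_TI_cents //.
  + exact: subset_trans sHG nKG.
  + exact: subset_trans sKG nHG.
have [K [defK nsKG piK sOK]] : exists K : {group gT},
  [/\ \big[dprod/1]_(p <- s) 'O_p(G) = K, K <| G, (prime_pred s).-group K
    & forall p, p \in s -> 'O_p(G) \subset K].
- elim: s uniq_s => [_ | p t IHt /= /andP[ntp /IHt[K [defK nsKG piK sOK]]]].
    by exists 1%G; rewrite big_nil; split; rewrite ?normal1 ?pgroup1.
  exists ('O_p(G) <*> K)%G; rewrite big_cons defK.
  have p'K : p^'.-group K.
    apply: sub_in_pnat piK => q _; rewrite !inE.
    by apply: contraTneq => ->.
  rewrite (dprod_normal p) ?pcore_normal ?pcore_pgroup //.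
  have nKO : 'O_p(G) \subset 'N(K).
    exact: subset_trans (pcore_sub _ _) (normal_norm nsKG).
  split; first by rewrite /= norm_joinEl.
  - by rewrite normalY ?pcore_normal.
  - rewrite /= norm_joinEl // pgroupM; apply/andP; split.
      apply: sub_in_pnat (pcore_pgroup p G) => q _; rewrite !inE => /eqP->.
      by rewrite eqxx.
    by apply: sub_in_pnat piK => q _; rewrite !inE => ->; rewrite orbT.
  move=> q; rewrite inE => /predU1P[-> | tq]; first exact: joing_subl.
  exact: subset_trans (sOK q tq) (joing_subr _ _).
rewrite /pi_special defK (dprod_normal (prime_pred s)) ?pcore_normal //;
  last exact: pcore_pgroup.
have nOK : K \subset 'N('O_(prime_pred s)^'(G)).
  exact: subset_trans (normal_sub nsKG) (gFnorm _ _).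
rewrite -norm_joinEl //; apply/eqP.
have sKOG : K <*> 'O_(prime_pred s)^'(G) \subset G.
  by rewrite join_subG normal_sub ?pcore_sub.
(* A prime dividing this index would divide the index of the Hall subgroup of its own colour. *)
rewrite eqEsubset sKOG -indexg_eq1 /=; apply: contraT => n1.
have /pdivP[q pr_q] : 1 < #|G : K <*> 'O_(prime_pred s)^'(G)|.
  by rewrite ltn_neqAle eq_sym n1 indexg_gt0.
have [sq | nsq] := boolP (q \in s).
  have sOq := subset_trans (sOK q sq) (joing_subl K 'O_(prime_pred s)^'(G)).
  move/dvdn_trans/(_ (indexgS _ sOq)) => qG.
  have /and3P[_ _ q'] := hallp q sq.
  by have := pnatP _ (indexg_gt0 _ _) q' q pr_q qG; rewrite !inE eqxx.
move/dvdn_trans/(_ (indexgS _ (joing_subr K 'O_(prime_pred s)^'(G)))) => qG.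
have /and3P[_ _ q'] := hall'.
have := pnatP _ (indexg_gt0 _ _) q' q pr_q qG.
by rewrite !inE negbK (negPf nsq).
Qed.

End PiSpecial.

Theorem corollary1p10 (s : seq nat) (gT : finGroupType) (G : {group gT})
    (A : 'I_4 -> {group gT}) :
  uniq s ->
  (forall p, p \in s -> prime p) ->
  (forall i, A i \subset G) ->
  (forall i j, i != j -> coprime #|G : A i| #|G : A j|) ->
  (forall i, (prime_pred s).-nat #|G : A i|
          \/ ((prime_pred s)^').-nat #|G : A i|) ->
  #|[set i : 'I_4 | ((prime_pred s)^').-nat #|G : A i|]| <= 1 ->
  (forall i, pi_special s (A i)^`(1)) ->
  pi_special s G^`(1).
Proof.
move=> uniq_s prime_s sAG coA piA card_pi' nilA.
apply: sigma_nilpotent_pi_special => //.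
apply: (@sigma_cover_der1_nilpotent _ _ _ A); split=> // [k | i]; last first.
  exact: pi_special_sigma_nilpotent (nilA i).
have [-> | nk0] := eqVneq k 0%N.
  have piE n : (colour_class (pi_colour s) 0)^'.-nat n = (prime_pred s).-nat n.
    by rewrite (eq_pnat _ (eq_negn (colour_class0 prime_s))) pnatNK.
  have [i0 pi'i0 | pi'0] := pickP (fun i => (prime_pred s)^'.-nat #|G : A i|).
    exists i0 => i ni0; rewrite piE; case: (piA i) => // pi'i.
    case/eqP: ni0; apply: (card_le1_eqP card_pi'); by rewrite inE.
  by exists ord0 => i _; rewrite piE; case: (piA i) => //; rewrite pi'0.
(* A nonzero colour class contains at most [k] itself, and by coprimality [k > 1] divides at most
   one index. *)
have ccP q : q \in colour_class (pi_colour s) k -> q = k.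
  rewrite inE /pi_colour; case: ifP => [_ /eqP // | _ /eqP k0].
  by rewrite -k0 eqxx in nk0.
have k'nat i :
  ~~ (k %| #|G : A i|) -> (colour_class (pi_colour s) k)^'.-nat #|G : A i|.
- move=> nkA; apply/pnatP => // q _; apply: contraL => /ccP->; exact: nkA.
have [i0 kA0 | nokA] := pickP (fun i => k %| #|G : A i|); last first.
  by exists ord0 => i _; apply: k'nat; rewrite nokA.
(* Coprimality says nothing about the divisor 1, but the class of colour 1 contains no prime. *)
have [k1 | nk1] := eqVneq k 1%N.
  exists ord0 => i _; apply/pnatP => // q pr_q _; apply/negP => /ccP eqk.
  by rewrite eqk k1 in pr_q.
exists i0 => i ni0; apply: k'nat; apply: contra nk1 => kAi.
by rewrite -dvdn1 -(eqnP (coA _ _ ni0)) dvdn_gcd kAi.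
Qed.
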